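(* Let $a,b>0$ and $p>1$. For each integer $k\ge 3$ let $\mathcal{P}_{p,k}$ be the polygon $P_0P_1\dots P_{k-1}$ (the union of its edges $[P_t,P_{t+1}]$, $t=0,\dots,k-1$, indices modulo $k$), where $$P_t=\frac{1}{\left\|\left(\cos\frac{2t\pi}{k},\sin\frac{2t\pi}{k}\right)\right\|_p}\left(\cos\frac{2t\pi}{k},\ \sin\frac{2t\pi}{k}\right),\quad t=0,1,\dots,k-1,$$ and let $\mathcal{Q}_{p,k}=\operatorname{conv}(\mathcal{P}_{p,k})$. Then $d_H(\mathcal{P}_{p,k},\mathcal{C}_p)\to 0$ as $k\to\infty$, and consequently $d_H(\mathcal{Q}_{p,k},\mathcal{D}_p)\to 0$ as $k\to\infty$.
   Context: $\|(x,y)\|_p=\left(|x/a|^p+|y/b|^p\right)^{1/p}$. The superellipse is $\mathcal{C}_p=\{(x,y)\in\mathbb{R}^2 \mid |x/a|^p+|y/b|^p=1\}$ and the superelliptic disk is $\mathcal{D}_p=\operatorname{conv}(\mathcal{C}_p)=\{(x,y)\in\mathbb{R}^2\mid |x/a|^p+|y/b|^p\le 1\}$. The points $P_t$ lie on $\mathcal{C}_p$. $d_H$ is the Hausdorff–Pompeiu distance with respect to the Euclidean norm: $d_H(A,B)=\max\{\sup_{x\in A}\inf_{y\in B}\|x-y\|,\sup_{y\in B}\inf_{x\in A}\|x-y\|\}$. *)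

(* Defs.v *)
From mathcomp Require Import all_boot all_order all_algebra.
From mathcomp Require Import all_classical all_reals all_analysis.
Set Implicit Arguments. Unset Strict Implicit. Unset Printing Implicit Defensive.
Import Order.TTheory GRing.Theory Num.Theory.
Local Open Scope classical_set_scope.
Local Open Scope ring_scope.

Section Defs.
Variable R : realType.
Notation pt := (R * R)%type.

Definition edist (u v : pt) : R := Num.sqrt ((u.1 - v.1) ^+ 2 + (u.2 - v.2) ^+ 2).

Definition setdist (x : pt) (B : set pt) : R := inf [set edist x y | y in B].
Definition dH (A B : set pt) : R :=
  Num.max (sup [set setdist x B | x in A]) (sup [set setdist y A | y in B]).

Definition pnorm (a b p : R) (u : pt) : R :=
  (`|u.1 / a| `^ p + `|u.2 / b| `^ p) `^ p^-1.

Definition superellipse (a b p : R) : set pt :=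
  [set u | `|u.1 / a| `^ p + `|u.2 / b| `^ p = 1].
Definition superdisk (a b p : R) : set pt :=
  [set u | `|u.1 / a| `^ p + `|u.2 / b| `^ p <= 1].

Definition vertex (a b p : R) (k t : nat) : pt :=
  let th := 2 * t%:R * pi / k%:R in
  let v := (cos th, sin th) in
  ((pnorm a b p v)^-1 * v.1, (pnorm a b p v)^-1 * v.2).

Definition segment (P Q : pt) : set pt :=
  [set u | exists2 s : R, 0 <= s <= 1 &
     u = ((1 - s) * P.1 + s * Q.1, (1 - s) * P.2 + s * Q.2)].

Definition polygon (a b p : R) (k : nat) : set pt :=
  \bigcup_(t in [set t : nat | (t < k)%N])
     segment (vertex a b p k t) (vertex a b p k ((t.+1) %% k)).

Definition convex_set (S : set pt) : Prop :=
  forall u v : pt, S u -> S v -> forall s : R, 0 <= s <= 1 ->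
    S ((1 - s) * u.1 + s * v.1, (1 - s) * u.2 + s * v.2).
Definition convhull (A : set pt) : set pt :=
  [set u | forall S : set pt, convex_set S -> A `<=` S -> S u].

End Defs.

(* Main.v *)
(* The curve th |-> v / |v|_p with v = (cos th, sin th) is continuous, hence
   uniformly continuous on [0, 2 pi], and it parametrizes the superellipse: the
   vertices of the polygon are its values at the multiples of 2 pi / k. So
   every point of an edge is close to the first endpoint of that edge, and every
   point of the superellipse is close to a vertex. For the convex hulls: the
   superelliptic disk is convex because t |-> t ^ p is, so it contains the hull of
   the polygon; conversely a point of the disk is a convex combination of two
   antipodal points of the superellipse, and the same combination of nearby
   points of the polygon lies in the hull. *)
Require Import Defs.
From mathcomp Require Import all_boot all_order all_algebra.
From mathcomp Require Import all_classical all_reals all_analysis.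
From mathcomp Require Import ring lra.
Import Order.TTheory GRing.Theory Num.Theory.
Import numFieldNormedType.Exports.
Local Open Scope classical_set_scope.
Local Open Scope ring_scope.

(* Estimates use the l1 distance, which dominates the Euclidean one and is
   additive over coordinates. *)
Definition taxi {R : realType} (u v : R * R) : R := `|u.1 - v.1| + `|u.2 - v.2|.

Definition lerp {R : realType} (s : R) (u v : R * R) : R * R :=
  ((1 - s) * u.1 + s * v.1, (1 - s) * u.2 + s * v.2).

(** * Bounding the Hausdorff distance by pointwise estimates *)

Section plane_distances.
Context {R : realType}.
Implicit Types (u v w : R * R) (A B : set (R * R)).

Lemma taxi_xx u : taxi u u = 0.
Proof. by rewrite /taxi !subrr normr0 addr0. Qed.

Lemma edist_le_taxi u v : Defs.edist u v <= taxi u v.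
Proof.
have h0 : 0 <= taxi u v by rewrite addr_ge0.
rewrite -[leRHS]ger0_norm// -sqrtr_sqr ler_wsqrtr// /taxi [leRHS]sqrrD !real_normK ?num_real//.
by rewrite lerD2r lerDl mulrn_wge0// mulr_ge0.
Qed.

Lemma taxi_lerp s u v u' v' : 0 <= s <= 1 ->
  taxi (lerp s u v) (lerp s u' v') <= (1 - s) * taxi u u' + s * taxi v v'.
Proof.
case/andP=> s0 s1; have s1' : 0 <= 1 - s by rewrite subr_ge0.
have h (x y x' y' : R) : `|(1 - s) * x + s * y - ((1 - s) * x' + s * y')| <=
    (1 - s) * `|x - x'| + s * `|y - y'|.
  rewrite (_ : _ - _ = (1 - s) * (x - x') + s * (y - y')); last by ring.
  by rewrite (le_trans (ler_normD _ _))// !normrM (ger0_norm s1') (ger0_norm s0).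
by rewrite /taxi !mulrDr addrACA lerD// h.
Qed.

Lemma setdist_ge0 u B : B !=set0 -> 0 <= setdist u B.
Proof.
move=> [v Bv]; apply: lb_le_inf; first by exists (Defs.edist u v), v.
by move=> _ [w _ <-]; exact: sqrtr_ge0.
Qed.

Lemma setdist_le_taxi u v B : B v -> setdist u B <= taxi u v.
Proof.
move=> Bv; apply: le_trans (edist_le_taxi u v).
by apply: ge_inf; [exists 0 => _ [w _ <-]; exact: sqrtr_ge0 | exists v].
Qed.

(** Nonemptiness and the bound [e] make both suprema genuine, so no default value of [sup] or [inf]
    interferes. The lower bound 0 is kept for the final squeeze. *)
Lemma dH_bounds A B (e : R) : A !=set0 -> B !=set0 ->
  (forall u, A u -> exists2 v, B v & taxi u v <= e) ->
  (forall v, B v -> exists2 u, A u & taxi v u <= e) ->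
  0 <= dH A B <= e.
Proof.
have side (X Y : set (R * R)) : X !=set0 -> Y !=set0 ->
    (forall u, X u -> exists2 v, Y v & taxi u v <= e) ->
    0 <= sup [set setdist x Y | x in X] <= e.
  move=> [x Xx] Y0 XY.
  have ub : ubound [set setdist x Y | x in X] e.
    by move=> _ [u /XY[v Yv uv] <-]; exact: le_trans (setdist_le_taxi _ _ _ Yv) uv.
  apply/andP; split.
    apply: le_trans (setdist_ge0 x _ Y0) _.
    by apply: ub_le_sup; [exists e | exists x].
  by apply: ge_sup ub; exists (setdist x Y), x.
move=> A0 B0 /(side _ _ A0 B0)/andP[l1 r1] /(side _ _ B0 A0)/andP[l2 r2].
by rewrite /dH le_max l1 ge_max r1 r2.
Qed.

End plane_distances.

(** * Convex hulls and convexity of the superelliptic disk *)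

Section convexity.
Context {R : realType}.
Implicit Types (u v w : R * R) (A S : set (R * R)).

Lemma convex_convhull A : Defs.convex_set (convhull A).
Proof.
by move=> u v hu hv s s01 S cS AS; apply: (cS) => //; [exact: hu | exact: hv].
Qed.

Lemma sub_convhull A : A `<=` convhull A.
Proof. by move=> u Au S _; apply. Qed.

Lemma convhull_sub A S : Defs.convex_set S -> A `<=` S -> convhull A `<=` S.
Proof. by move=> cS AS u; apply. Qed.

(** The triangle inequality and monotonicity of the power reduce this to convexity of [t ^ p] on
    nonnegative reals. *)
Lemma ler_powR_lerp (p s x y : R) : 1 <= p -> 0 <= s <= 1 ->
  `|(1 - s) * x + s * y| `^ p <= (1 - s) * `|x| `^ p + s * `|y| `^ p.
Proof.
move=> p1 /andP[s0 s1]; have s1' : 0 <= 1 - s by rewrite subr_ge0.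
apply: (@le_trans _ _ (((1 - s) * `|x| + s * `|y|) `^ p)).
  rewrite ge0_ler_powR ?nnegrE ?(le_trans _ p1)//.
    by rewrite addr_ge0// mulr_ge0.
  by rewrite (le_trans (ler_normD _ _))// !normrM (ger0_norm s1') (ger0_norm s0).
have := @convex_powR R p p1 (Itv01 s0 s1) `|y| `|x|.
rewrite !inE/= !in_itv/= !normr_ge0 => /(_ isT isT) h.
by rewrite addrC [leRHS]addrC; exact: h.
Qed.

Lemma convex_superdisk (a b p : R) : 1 <= p -> Defs.convex_set (superdisk a b p).
Proof.
move=> p1 u v; rewrite /superdisk /= => hu hv s s01.
have /andP[s0 s1] := s01.
have := lerD (ler_powR_lerp _ _ (u.1 / a) (v.1 / a) p1 s01)
             (ler_powR_lerp _ _ (u.2 / b) (v.2 / b) p1 s01).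
rewrite !mulrA -!mulrDl => /le_trans; apply.
have := ler_wpM2l s0 hv; have := @ler_wpM2l _ (1 - s) _ _ _ hu.
rewrite subr_ge0 => /(_ s1); lra.
Qed.

End convexity.

(** * Uniform continuity of plane curves *)

Section uniform_continuity.
Context {R : realType}.

(** Heine's theorem, via the near-covering form of compactness. Only [x] is confined to the
    interval, so the second parameter never has to be located. *)
Lemma near0_taxi_itv (g1 g2 : R -> R) (c d e : R) : 0 < e ->
  continuous g1 -> continuous g2 ->
  \forall r \near 0^'+, forall x y, c <= x <= d -> `|x - y| < r ->
    taxi (g1 x, g2 x) (g1 y, g2 y) <= e.
Proof.
move=> e0 c1 c2.
have := @segment_compact R c d; move=> /compact_near_coveringP.
move=> /(_ R (0^'+) (fun r x => forall y, `|x - y| < r ->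
    taxi (g1 x, g2 x) (g1 y, g2 y) <= e) _); case.
  move=> x _.
  (* Going from [z] to [y] through [x] costs two such errors in each of the two coordinates. *)
  have e4 : 0 < e / 4 by lra.
  have : \forall z \near x, `|g1 x - g1 z| < e / 4 /\ `|g2 x - g2 z| < e / 4.
    by near=> z; split; near: z;
      [have /cvgrPdist_lt := c1 x | have /cvgrPdist_lt := c2 x]; apply.
  move=> /nbhs_ballP[r /= r0 hr].
  (* Halving the radius keeps [y], which is within [r / 2] of [z], inside the ball of radius [r]
     around [x]. *)
  exists (ball x (r / 2), [set i | i < r / 2]).
    split; first by apply: nbhsx_ballx; rewrite divr_gt0.
    by apply: nbhs_right_lt; rewrite divr_gt0.
  move=> [z i] /= [xz ir] y zy.
  have [z1 z2] : `|g1 x - g1 z| < e / 4 /\ `|g2 x - g2 z| < e / 4.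
    by apply: hr; move: xz; rewrite /ball /=; lra.
  have [y1 y2] : `|g1 x - g1 y| < e / 4 /\ `|g2 x - g2 y| < e / 4.
    apply: hr; move: xz; rewrite /ball /= => xz.
    by have := ler_distD z x y; lra.
  have := ler_distD (g1 x) (g1 z) (g1 y); have := ler_distD (g2 x) (g2 z) (g2 y).
  by rewrite (distrC (g1 z) (g1 x)) (distrC (g2 z) (g2 x)) /taxi /=; lra.
move=> r /= r0 hr; exists r => //= s s0 s1 x y xcd xy.
by apply: (hr s s0 s1 x _ y xy); rewrite /= in_itv.
Unshelve. all: by end_near. Qed.

End uniform_continuity.

(** Away from 0 the power is differentiable; at 0, where it need not be, the explicit radius
    [e ^ (1/p)] works. *)
Lemma continuous_norm_powR {R : realType} (p : R) :
  0 < p -> continuous (fun x : R => `|x| `^ p).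
Proof.
move=> p0 x; have [->|x0] := eqVneq x 0.
  apply/cvgrPdist_lt => e e0; rewrite normr0 powR0 ?gt_eqF//.
  have d0 : 0 < e `^ p^-1 by exact: powR_gt0.
  near=> y; have yd : `|y| < e `^ p^-1 by near: y; exact: (@nbhs0_lt R R^o _ d0).
  rewrite sub0r normrN ger0_norm ?powR_ge0//.
  rewrite -[ltRHS](powRr1 (ltW e0)) -(mulVf (lt0r_neq0 p0)) powRrM.
  by apply: gt0_ltr_powR; rewrite ?nnegrE ?powR_ge0.
apply: (@continuous_comp _ _ _ (fun y : R => `|y|) (@powR R ^~ p)).
  exact: norm_continuous.
apply: differentiable_continuous; apply/derivable1_diffP; apply: derivable_powR.
by rewrite in_itv/= normr_gt0 x0.
Unshelve. all: by end_near. Qed.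

(** [acos x] serves the upper half circle; on the lower half it is reflected to [2 pi - acos x]. *)
Lemma polar_angle {R : realType} (x y : R) : x ^+ 2 + y ^+ 2 = 1 ->
  exists2 th : R, 0 <= th <= pi *+ 2 & x = cos th /\ y = sin th.
Proof.
move=> xy1; have x1 : -1 <= x <= 1 by nra.
have yE : `|y| = sin (acos x).
  by rewrite sin_acos// -xy1 addrAC subrr add0r sqrtr_sqr.
have xK : cos (acos x) = x by rewrite acosK// in_itv.
have h0 := acos_ge0 x1; have hpi := acos_lepi x1; have pi0 := pi_ge0 R.
have [y0|y0] := leP 0 y.
  exists (acos x); first by rewrite h0/= mulr2n; lra.
  by rewrite xK -yE ger0_norm.
exists (- acos x + pi *+ 2); first by rewrite mulr2n; lra.
by rewrite cosD2pi sinD2pi cosN sinN xK -yE ltr0_norm// opprK.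
Qed.

(** The formula of [vertex] with a free angle, so that vertices are its values by mere unfolding. *)
Definition radial_pt {R : realType} (a b p th : R) : R * R :=
  let v := (cos th, sin th) in
  ((pnorm a b p v)^-1 * v.1, (pnorm a b p v)^-1 * v.2).

(** * The superellipse as unit curve of [pnorm] and its radial parametrization *)

Section superellipse.
Context {R : realType} {a b p : R}.
Context (ha : 0 < a) (hb : 0 < b) (hp : 1 < p).
Implicit Types (u v : R * R).

Let p0 : 0 < p. Proof. exact: lt_trans hp. Qed.

Lemma powR_pnorm u : pnorm a b p u `^ p = `|u.1 / a| `^ p + `|u.2 / b| `^ p.
Proof. by rewrite -powRrM mulVf ?gt_eqF// powRr1// addr_ge0// powR_ge0. Qed.

Lemma superellipseP u : superellipse a b p u <-> pnorm a b p u = 1.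
Proof.
rewrite /superellipse /= -powR_pnorm; split=> [|->]; last by rewrite powR1.
move/eqP; rewrite powR_eq1 (gt_eqF p0) orbF ltNge powR_ge0 orbF.
by move/eqP.
Qed.

Lemma superdisk_pnorm_le1 u : superdisk a b p u -> pnorm a b p u <= 1.
Proof.
rewrite /superdisk /= -powR_pnorm => h1; rewrite leNgt; apply/negP => h.
have := gt0_ltr_powR p0; move=> /(_ 1 (pnorm a b p u)).
by rewrite !nnegrE ler01 powR_ge0 => /(_ isT isT h); rewrite powR1 ltNge h1.
Qed.

Lemma pnormZ r u : pnorm a b p (r * u.1, r * u.2) = `|r| * pnorm a b p u.
Proof.
have h x c : `|r * x / c| `^ p = `|r| `^ p * `|x / c| `^ p by rewrite -mulrA normrM powRM.
rewrite /pnorm /= !h -mulrDr powRM ?powR_ge0 ?addr_ge0 ?powR_ge0//.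
by rewrite -powRrM mulfV ?gt_eqF// powRr1.
Qed.

Lemma pnorm_gt0 u : u != 0 -> 0 < pnorm a b p u.
Proof.
move=> u0; rewrite lt0r powR_ge0 andbT powR_eq0 negb_and; apply/orP; left.
rewrite paddr_eq0 ?powR_ge0// !powR_eq0 (gt_eqF p0) !andbT !normr_eq0 !mulf_eq0.
rewrite !invr_eq0 (gt_eqF ha) (gt_eqF hb) !orbF.
by apply: contra u0 => /andP[/eqP h1 /eqP h2]; rewrite (surjective_pairing u) h1 h2.
Qed.

Lemma cos_sin_neq0 (th : R) : (cos th, sin th) != 0.
Proof.
apply/eqP => -[c0 s0]; have := cos2Dsin2 th.
by rewrite c0 s0 expr0n addr0 => /eqP; rewrite eq_sym oner_eq0.
Qed.

Lemma radial_pt_superellipse th : superellipse a b p (radial_pt a b p th).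
Proof.
have h := pnorm_gt0 _ (cos_sin_neq0 th).
by apply/superellipseP; rewrite pnormZ ger0_norm ?invr_ge0 ?ltW// mulVf// gt_eqF.
Qed.

(** Write [u = r (cos th, sin th)]. By homogeneity [pnorm] of the direction is [1 / r], so
    normalizing the direction multiplies it by [r] and returns [u]. *)
Lemma superellipse_radial_pt u : superellipse a b p u ->
  exists2 th, 0 <= th <= pi *+ 2 & u = radial_pt a b p th.
Proof.
move=> /superellipseP u1; pose r := Num.sqrt (u.1 ^+ 2 + u.2 ^+ 2).
have r2 : r ^+ 2 = u.1 ^+ 2 + u.2 ^+ 2 by rewrite sqr_sqrtr// addr_ge0// sqr_ge0.
have r0 : 0 < r.
  rewrite lt0r sqrtr_ge0 andbT; apply/eqP => r0; move: r2; rewrite r0 expr0n/=.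
  move/esym/eqP; rewrite paddr_eq0 ?sqr_ge0// !sqrf_eq0 => /andP[/eqP x0 /eqP y0].
  move: u1; rewrite (surjective_pairing u) x0 y0.
  have := pnormZ 0 (0, 0); rewrite /= mulr0 normr0 mul0r => -> /eqP.
  by rewrite eq_sym oner_eq0.
have [|th th01 [xE yE]] := @polar_angle R (r^-1 * u.1) (r^-1 * u.2).
  by rewrite !exprMn -mulrDr -r2 -exprMn mulVf ?expr1n// gt_eqF.
exists th => //; rewrite /radial_pt -xE -yE pnormZ u1 mulr1/=.
rewrite ger0_norm ?invr_ge0 ?ltW// invrK !mulrA mulfV ?gt_eqF// !mul1r.
exact: surjective_pairing.
Qed.

Lemma continuous_pnorm_cos_sin : continuous (fun th => pnorm a b p (cos th, sin th)).
Proof.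
move=> th; rewrite /pnorm /=.
(* The sum is nonnegative, so an absolute value may be inserted to make [continuous_norm_powR] apply
   to the outer root. *)
rewrite (_ : (fun th : R => _) = (fun z : R => `|z| `^ p^-1) \o
   (fun th => `|cos th / a| `^ p + `|sin th / b| `^ p)); last first.
  by apply/funext => x /=; rewrite [`| _ + _ |]ger0_norm// addr_ge0// powR_ge0.
apply: continuous_comp; last by apply: continuous_norm_powR; rewrite invr_gt0.
apply: cvgD.
  apply: (@continuous_comp _ _ _ (fun x => cos x / a) (fun z : R => `|z| `^ p)).
    by apply: cvgMr_tmp; exact: continuous_cos.
  exact: continuous_norm_powR.
apply: (@continuous_comp _ _ _ (fun x => sin x / b) (fun z : R => `|z| `^ p)).
  by apply: cvgMr_tmp; exact: continuous_sin.
exact: continuous_norm_powR.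
Qed.

Lemma continuous_radial_pt :
  continuous (fun th => (radial_pt a b p th).1) /\
  continuous (fun th => (radial_pt a b p th).2).
Proof.
have h th : {for th, continuous (fun th => (pnorm a b p (cos th, sin th))^-1)}.
  apply: cvgV; first by rewrite gt_eqF// pnorm_gt0// cos_sin_neq0.
  exact: continuous_pnorm_cos_sin.
split=> th; apply: cvgM; [exact: h|exact: continuous_cos|exact: h|exact: continuous_sin].
Qed.

End superellipse.

(** * Vertices of the polygon as samples of the curve *)

Section polygon.
Context {R : realType} {a b p : R}.
Context (ha : 0 < a) (hb : 0 < b) (hp : 1 < p).
Implicit Types (u v : R * R).

Lemma near_radial_pt_mesh (e : R) : 0 < e ->
  \forall k \near \oo, forall x y : R, 0 <= x <= pi *+ 2 ->
    `|x - y| <= 2 * pi / k.+3%:R ->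
    taxi (radial_pt a b p x) (radial_pt a b p y) <= e.
Proof.
move=> e0; have [c1 c2] := continuous_radial_pt ha hb hp.
(* A single modulus [r] is fixed before [k]; the mesh angle eventually drops below it. *)
have [r [r0 hr]] : exists r : R, 0 < r /\ forall x y : R, 0 <= x <= pi *+ 2 ->
    `|x - y| < r -> taxi (radial_pt a b p x) (radial_pt a b p y) <= e.
  have : \forall r \near 0^'+, 0 < r /\ forall x y : R, 0 <= x <= pi *+ 2 ->
    `|x - y| < r -> taxi (radial_pt a b p x) (radial_pt a b p y) <= e.
    near=> r; split; near: r; first exact: nbhs_right_gt.
    exact: near0_taxi_itv c1 c2.
  by move/filter_ex.
near=> k; move=> x y x01 xy; apply: hr => //; apply: le_lt_trans xy _.
rewrite ltr_pdivrMr// [ltRHS]mulrC -ltr_pdivrMr//.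
have : 2 * pi / r < k%:R by near: k; exact: nbhs_infty_gtr.
by move/lt_le_trans; apply; rewrite ler_nat -addn3 leq_addr.
Unshelve. all: by end_near. Qed.

(** The case [t = k] is the wrap-around: angles 0 and [2 pi] give the same point, so the closing
    edge needs no separate treatment later. *)
Lemma vertex_modn k t : (t <= k)%N ->
  vertex a b p k (t %% k) = radial_pt a b p (2 * t%:R * pi / k%:R).
Proof.
case: k => [|k]; first by rewrite leqn0 => /eqP ->.
rewrite leq_eqVlt => /orP[/eqP ->|tk]; last by rewrite modn_small.
have k0 : k.+1%:R != 0 :> R by rewrite pnatr_eq0.
rewrite modnn (_ : 2 * k.+1%:R * pi / k.+1%:R = pi *+ 2); last first.
  by rewrite mulr2n; field.
by rewrite /vertex /radial_pt mulr0 !mul0r cos2pi sin2pi cos0 sin0.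
Qed.

Lemma radial_pt_polygon k t : (0 < k)%N -> (t <= k)%N ->
  polygon a b p k (radial_pt a b p (2 * t%:R * pi / k%:R)).
Proof.
move=> k0 tk; rewrite -vertex_modn//; exists (t %% k)%N; first exact: ltn_pmod.
exists 0; first by rewrite lexx ler01.
by rewrite !subr0 !mul1r !mul0r !addr0; exact: surjective_pairing.
Qed.

Lemma angle_itv k t : (t <= k)%N -> 0 <= (2 * t%:R * pi / k%:R : R) <= pi *+ 2.
Proof.
have pi0 := pi_ge0 R; move=> tk; rewrite divr_ge0 ?mulr_ge0//=.
case: k tk => [|k] tk; first by rewrite invr0 mulr0 mulrn_wge0.
rewrite ler_pdivrMr// -mulrA [t%:R * _]mulrC mulrA -[pi *+ 2]mulr_natl.
by rewrite ler_wpM2l ?mulr_ge0// ler_nat.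
Qed.

(** * Approximation in both directions for a fixed number of vertices *)

Section mesh.
Context (k : nat) (e : R) (k0 : (0 < k)%N).
Context (mesh : forall x y : R, 0 <= x <= pi *+ 2 ->
  `|x - y| <= 2 * pi / k%:R ->
  taxi (radial_pt a b p x) (radial_pt a b p y) <= e).

Let kR0 : 0 < k%:R :> R. Proof. by rewrite ltr0n. Qed.

Lemma polygon_near_superellipse u : polygon a b p k u ->
  exists2 v, superellipse a b p v & taxi u v <= e.
Proof.
move=> [t /= tk [s /andP[s0 s1] ->]]; rewrite vertex_modn//.
pose P := radial_pt a b p (2 * t%:R * pi / k%:R).
pose Q := radial_pt a b p (2 * t.+1%:R * pi / k%:R).
exists P; first exact: radial_pt_superellipse.
have PQ : taxi P Q <= e.
  apply: mesh; first by apply: angle_itv; exact: ltnW.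
  have -> : 2 * t%:R * pi / k%:R - 2 * t.+1%:R * pi / k%:R = - (2 * pi / k%:R) :> R.
    by rewrite -[t.+1%:R]natr1; ring.
  rewrite normrN ger0_norm//.
  by rewrite divr_ge0// mulr_ge0// pi_ge0.
rewrite (_ : vertex a b p k t = P)//.
(* Distance from the first endpoint grows linearly along the edge, so it is at most the edge
   length. *)
have -> : taxi ((1 - s) * P.1 + s * Q.1, (1 - s) * P.2 + s * Q.2) P = s * taxi P Q.
  have h (x y : R) : `|(1 - s) * x + s * y - x| = s * `|x - y|.
    by rewrite -[s in RHS](ger0_norm s0) -normrM -normrN; congr `|_|; ring.
  by rewrite /taxi !h mulrDr.
by apply: le_trans PQ; rewrite ler_piMl// addr_ge0.
Qed.

Lemma superellipse_near_polygon v : superellipse a b p v ->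
  exists2 u, polygon a b p k u & taxi v u <= e.
Proof.
move=> /(superellipse_radial_pt hp)[th /[dup] th01 /andP[th0 th1] ->].
have pi0 := pi_gt0 R; have pi2 : 0 < 2 * pi :> R by rewrite mulr_gt0.
(* [x] is [th] measured in mesh steps, and its integer part [t] selects the vertex at or just before
   [th]. The value [t = k] occurs when [th = 2 pi]. *)
pose x := th * k%:R / (2 * pi); have x0 : 0 <= x.
  by rewrite divr_ge0 ?mulr_ge0// ltW.
pose t := Num.truncn x; have /andP[tx xt] := truncn_itv x0.
have tk : (t <= k)%N.
  rewrite -(ler_nat R); apply: le_trans tx _.
  by rewrite ler_pdivrMr// mulrC ler_pM2l// mulr_natl.
exists (radial_pt a b p (2 * t%:R * pi / k%:R)); first exact: radial_pt_polygon.
apply: mesh => //.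
(* The angular gap is the fractional part of [x] times one mesh step. *)
have rescale (y m P K : R) : P != 0 -> K != 0 ->
    y - 2 * m * P / K = (y * K / (2 * P) - m) * (2 * P / K).
  by move=> P0 K0; field; rewrite P0 K0.
rewrite rescale ?lt0r_neq0// -/x.
have m0 : 0 <= 2 * pi / k%:R :> R by rewrite divr_ge0// ltW.
rewrite normrM (ger0_norm m0) ler_piMl// ger0_norm ?subr_ge0//.
by rewrite lerBlDr addrC natr1 ltW.
Qed.

Lemma convhull_polygon_superdisk : convhull (polygon a b p k) `<=` superdisk a b p.
Proof.
have cD : Defs.convex_set (superdisk a b p) by apply: convex_superdisk; exact: ltW.
apply: convhull_sub => // u [t /= tk [s s01 ->]].
have CD v : superellipse a b p v -> superdisk a b p v.
  by rewrite /superellipse /superdisk /= => ->.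
by rewrite vertex_modn//; apply: cD => //; apply: CD; exact: radial_pt_superellipse.
Qed.

(* A point of the disk lies on the chord joining two antipodal points of the curve. *)
Lemma superdisk_near_convhull v : superdisk a b p v ->
  exists2 u, convhull (polygon a b p k) u & taxi v u <= e.
Proof.
move=> /(superdisk_pnorm_le1 hp); set r := pnorm a b p v => r1.
have r0 : 0 <= r by exact: powR_ge0.
have [c cC vE] : exists2 c, superellipse a b p c & v = (r * c.1, r * c.2).
  (* The origin has no direction to normalize, but there [r = 0] and any point of the curve serves
     as [c]. *)
  have [v0|v0] := eqVneq v 0.
    exists (radial_pt a b p 0); first exact: radial_pt_superellipse.
    have -> : r = 0.
      have := @pnormZ _ a b p hp 0 v; rewrite !mul0r normr0 mul0r => <-.
      by rewrite /r v0.
    by rewrite !mul0r v0.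
  have rgt0 := pnorm_gt0 ha hb hp v v0.
  exists (r^-1 * v.1, r^-1 * v.2).
    by apply/(superellipseP hp); rewrite pnormZ// ger0_norm ?invr_ge0// mulVf// gt_eqF.
  by rewrite /= !mulrA mulfV ?gt_eqF// !mul1r; exact: surjective_pairing.
have cC' : superellipse a b p (-1 * c.1, -1 * c.2).
  apply/(superellipseP hp); rewrite pnormZ// normrN1 mul1r.
  exact/(superellipseP hp).
have [u Pu cu] := superellipse_near_polygon _ cC.
have [w Pw cw] := superellipse_near_polygon _ cC'.
(* Weight [s] on the antipode gives [(1 - 2 s) c], which equals [r c] exactly for this [s]. *)
have s01 : 0 <= (1 - r) / 2 <= 1 by apply/andP; split; lra.
exists (lerp ((1 - r) / 2) u w).
  by apply: convex_convhull => //; exact: sub_convhull.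
have -> : v = lerp ((1 - r) / 2) c (-1 * c.1, -1 * c.2).
  by rewrite vE /lerp /=; congr pair; field.
apply: le_trans (taxi_lerp _ _ _ _ _ s01) _.
have := ler_wpM2l r0 cu; nra.
Qed.

End mesh.

End polygon.

(** * Passage to the limit *)

Lemma cvg0_squeeze {R : realType} (f : nat -> R) :
  (forall e, 0 < e -> \forall k \near \oo, 0 <= f k <= e) -> f @ \oo --> 0.
Proof.
move=> h; apply/cvgrPdist_le => e e0; near=> k; rewrite sub0r normrN.
have /andP[f0 fe] : 0 <= f k <= e by near: k; exact: h.
by rewrite ger0_norm.
Unshelve. all: by end_near. Qed.

Theorem theorem3p10 (R : realType) (a b p : R) (ha : 0 < a) (hb : 0 < b) (hp : 1 < p) :
  (fun k : nat => dH (polygon a b p k.+3) (superellipse a b p)) @ \oo --> 0 /\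
  (fun k : nat => dH (convhull (polygon a b p k.+3)) (superdisk a b p)) @ \oo --> 0.
Proof.
have C0 : superellipse a b p !=set0.
  by exists (radial_pt a b p 0); exact: radial_pt_superellipse.
have P0 k : polygon a b p k.+3 !=set0.
  by eexists; exact: (@radial_pt_polygon R a b p k.+3 0).
split; apply: cvg0_squeeze => e e0;
    apply: filterS (near_radial_pt_mesh ha hb hp e e0) => k mesh.
  apply: dH_bounds => // u; first exact: polygon_near_superellipse.
  exact: superellipse_near_polygon.
have Q0 : convhull (polygon a b p k.+3) !=set0.
  by have [u Pu] := P0 k; exists u; exact: sub_convhull.
have sub := @convhull_polygon_superdisk R a b p ha hb hp k.+3.
apply: dH_bounds => //; first by have [u /sub] := Q0; exists u.
  (* The hull lies inside the disk, so each of its points is its own approximation. *)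
  by move=> u /sub Du; exists u => //; rewrite taxi_xx ltW.
exact: superdisk_near_convhull.
Qed.
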